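(* Let $G$ be a loopless directed graph (multiple edges allowed) on the vertex set $[n]$, each of whose edges is directed from its smaller to its larger endpoint. Then for any $\mathbf v\in\mathbb Z^n$ and every $i,j\in[n]$, $$K_G(\mathbf v)^2\ \ge\ K_G(\mathbf v+e_i-e_j)\,K_G(\mathbf v-e_i+e_j).$$
   Context: Graphs are finite. $e_i$ is the $i$-th standard basis vector of $\mathbb Z^n$. The Kostant partition function $K_G(\mathbf v)$ of a loopless directed multigraph $G$ on $[n]$ with edges directed from smaller to larger vertices is the number of ways to write $\mathbf v$ as a nonnegative integer combination of the vectors attached to the edges of $G$, an edge from $i$ to $j$ ($i<j$) having vector $e_i-e_j$ (parallel edges counted as distinct); that is, $K_G(\mathbf v)$ is the number of $f\in\mathbb Z_{\ge0}^{E(G)}$ with $\sum_{\epsilon=(i\to j)\in E(G)}f_\epsilon(e_i-e_j)=\mathbf v$. *)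

(* Defs.v *)
From HB Require Import structures.
From mathcomp Require Import all_boot all_order all_algebra finmap.
From mathcomp Require Import boolp classical_sets cardinality.

Set Implicit Arguments.
Unset Strict Implicit.
Unset Printing Implicit Defensive.

Import Order.TTheory GRing.Theory Num.Theory.
Local Open Scope classical_set_scope.
Local Open Scope ring_scope.

(* The vertex set [n] is 'I_n.  Parallel edges are distinct elements of [edge];
   [edge_incr] makes the graph loopless with edges going from the smaller to
   the larger endpoint. *)
Record increasing_digraph (n : nat) := IncreasingDigraph {
  edge : finType;
  src : edge -> 'I_n;
  tgt : edge -> 'I_n;
  edge_incr : forall x : edge, (src x < tgt x)%N
}.

Definition basis_vec (n : nat) (i : 'I_n) : 'rV[int]_n := delta_mx 0 i.

Definition kostant_flows (n : nat) (G : increasing_digraph n)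
    (v : 'rV[int]_n) : set {ffun edge G -> nat} :=
  [set f | \sum_(x : edge G) (basis_vec (src x) - basis_vec (tgt x)) *+ f x = v].
Arguments kostant_flows {n} G v.

(* [fset_set] is empty on infinite sets; [finite_kostant_flows] below shows
   that this case never occurs. *)
Definition kostant (n : nat) (G : increasing_digraph n) (v : 'rV[int]_n) : nat :=
  #|` fset_set (kostant_flows G v)|%fset.

Lemma finite_kostant_flows (n : nat) (G : increasing_digraph n)
  (v : 'rV[int]_n) : finite_set (kostant_flows G v).
Proof.
(* Pairing with the weights -k bounds every coordinate of a flow. *)
pose w (u : 'rV[int]_n) : int := \sum_(k < n) u 0 k * - (k : nat)%:Z.
have wb (i : 'I_n) : w (basis_vec i) = - (i : nat)%:Z.
  rewrite /w (bigD1 i) //= big1 => [|k ki]; first by rewrite mxE !eqxx mul1r addr0.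
  by rewrite mxE (negPf ki) andbF mul0r.
have wD (a b : 'rV[int]_n) : w (a - b) = w a - w b.
  by rewrite /w -sumrB; apply: eq_bigr => k _; rewrite !mxE mulrBl.
have w0 : w 0 = 0 by rewrite /w big1 // => k _; rewrite mxE mul0r.
have wA (a b : 'rV[int]_n) : w (a + b) = w a + w b.
  by rewrite /w -big_split; apply: eq_bigr => k _; rewrite !mxE mulrDl.
have wM (a : 'rV[int]_n) m : w (a *+ m) = w a *+ m.
  by elim: m => [|m IH]; rewrite ?mulr0n ?w0 // !mulrS wA IH.
pose N := `|w v|%N.
pose widen (g : {ffun edge G -> 'I_N.+1}) : {ffun edge G -> nat} :=
  [ffun x => g x : nat].
apply: (@sub_finite_set _ _ (widen @` setT)); last exact/finite_image/finite_finset.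
move=> f /= fv.
have step y :
    (f y : int) <= w ((basis_vec (src y) - basis_vec (tgt y)) *+ f y).
  rewrite wM wD !wb opprK addrC -mulr_natr natz ler_peMl //.
  by rewrite -gtz0_ge1 subr_gt0 ltz_nat edge_incr.
have fN x : (f x <= N)%N.
  rewrite -lez_nat (le_trans (step x)) // (le_trans _ (ler_norm _)) //.
  rewrite -fv (big_morph w wA w0) (bigD1 x) //= lerDl sumr_ge0 // => y _.
  by rewrite (le_trans _ (step y)).
exists [ffun x => inord (f x)] => //.
by apply/ffunP => x; rewrite !ffunE inordK // ltnS fN.
Qed.

(* Main.v *)
(* Write K(v) as the limit r -> 0+ of c_r(v) = \sum_g r ^ |v - net(g)|^2, where g
   runs over the flows with values in [0, N], N large, and net(g) is the vector
   that g sums to.  All values of c_r are positive, and for every b the form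
   Q_b = (c_r(b + e_k + e_l))_{k,l} has at most one positive eigenvalue; its
   2 x 2 minors give the inequality.  For a graph without edges this is a direct
   computation with a Gaussian.  Adding an edge i -> j replaces Q_b by the sum of
   the forms Q_t := Q_{b - t (e_i - e_j)}, t = 0..N, which are chained by
   Q_t e_j = Q_{t+1} e_i.  The numbers q_t = Q_t(e_i, e_i) are log-concave, hence
   unimodal; on either side of the mode the values Q_t(x, x) are bounded by
   telescoping differences of l_t(x)^2 / |q_{t+1} - q_t|, where
   l_t(x) = Q_t(e_i, x), and the bounds meeting at the mode show that
   \sum_t Q_t is nonpositive on a hyperplane. *)
Require Import Defs.
From mathcomp Require Import all_boot all_order all_algebra.
From mathcomp Require Import finmap boolp classical_sets cardinality.
From mathcomp Require Import ring lra zify.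

Set Implicit Arguments.
Unset Strict Implicit.
Unset Printing Implicit Defensive.

Import Order.TTheory GRing.Theory Num.Theory.
Local Open Scope ring_scope.

(** * Scalar inequalities along a log-concave chain *)

Lemma discriminant_le (R : realFieldType) (A B C : R) :
  0 <= C -> (forall s, 0 <= A + 2 * s * B + s ^+ 2 * C) -> B ^+ 2 <= A * C.
Proof.
rewrite le_eqVlt => /predU1P[<-|C0] H.
  have [->|B0] := eqVneq B 0; first by rewrite mulr0 expr0n.
  (* For [C = 0] the polynomial is affine in [s]; this [s] gives it the value -1. *)
  have := H (- (A + 1) / (2 * B)).
  have -> : A + 2 * (- (A + 1) / (2 * B)) * B + (- (A + 1) / (2 * B)) ^+ 2 * 0 = -1.
    by field.
  by rewrite lerNr oppr0 ler10.
have := H (- B / C).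
have -> : A + 2 * (- B / C) * B + (- B / C) ^+ 2 * C = (A * C - B ^+ 2) / C.
  by field; rewrite gt_eqF.
by rewrite pmulr_lge0 ?invr_gt0 // subr_ge0.
Qed.

(* The constraints that a form with at most one positive eigenvalue puts on its
   values at vectors e, e' and x, where q0, q1, q2 = Q(e,e), Q(e,e'), Q(e',e'),
   l1 = Q(e,x), l2 = Q(e',x) and Q = Q(x,x).  The last one is the sign of the
   Gram determinant of e, e', x. *)
Record chain_ineq (R : realFieldType) (q0 q1 q2 l1 l2 Q : R) : Prop := ChainIneq {
  chain_left : q0 * Q <= l1 ^+ 2;
  chain_right : q2 * Q <= l2 ^+ 2;
  chain_gram : (q1 ^+ 2 - q0 * q2) * Q + q0 * l2 ^+ 2 - 2 * q1 * l1 * l2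
               + q2 * l1 ^+ 2 <= 0 }.

Lemma chain_ineq_sym (R : realFieldType) (q0 q1 q2 l1 l2 Q : R) :
  chain_ineq q0 q1 q2 l1 l2 Q -> chain_ineq q2 q1 q0 l2 l1 Q.
Proof. by case=> h1 h2 h3; split=> //; lra. Qed.

(* S <= l ^ 2 / b, read as "S <= 0 on l = 0" when b = 0. *)
Definition dominated (R : realFieldType) (b l S : R) :=
  b * S <= l ^+ 2 /\ (l = 0 -> S <= 0).

(** When [a = q2 - q1] and [b = q1 - q0] are positive, the point is
    [Q <= l2 ^+ 2 / a - l1 ^+ 2 / b], which telescopes along an increasing stretch. Vanishing [a] or
    [b] is treated apart. *)
Lemma dominated_step (R : realFieldType) (q0 q1 q2 l1 l2 Q S : R) :
  0 < q0 -> 0 < q1 -> 0 < q2 -> q0 * q2 <= q1 ^+ 2 -> q1 <= q2 ->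
  chain_ineq q0 q1 q2 l1 l2 Q -> dominated (q1 - q0) l1 S ->
  dominated (q2 - q1) l2 (S + Q).
Proof.
move=> q0p q1p q2p D q12 [h1 h2 h3] [hb hl].
have q01 : q0 <= q1 by nra.
move: q01; rewrite le_eqVlt => /predU1P[e|q01].
  (* For [q0 = q1], log-concavity leaves no room to increase, and the Gram inequality becomes
     [q1 * (l2 - l1) ^+ 2 <= 0]. *)
  have e2 : q2 = q1 by nra.
  subst q0 q2.
  have el : l1 = l2.
    suff : (l2 - l1) ^+ 2 <= 0 by move=> h; apply/eqP; rewrite eq_sym -subr_eq0 -sqrf_eq0 eq_le h sqr_ge0.
    by rewrite -(pmulr_rle0 _ q1p); nra.
  split; first by rewrite subrr mul0r sqr_ge0.
  move=> l20; have := hl (etrans el l20); rewrite l20 in h2; nra.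
have b0 : 0 < q1 - q0 by rewrite subr_gt0.
move: q12; rewrite le_eqVlt => /predU1P[e|q12].
  subst q2; split; first by rewrite subrr mul0r sqr_ge0.
  move=> l20; subst l2.
  have hQ : (q1 - q0) * Q <= - l1 ^+ 2.
    have : q1 * ((q1 - q0) * Q + l1 ^+ 2) <= 0 by nra.
    by rewrite pmulr_rle0 // => ?; lra.
  by rewrite -(pmulr_rle0 _ b0); lra.
have a0 : 0 < q2 - q1 by rewrite subr_gt0.
suff H : (q2 - q1) * (S + Q) <= l2 ^+ 2.
  by split=> // l20; rewrite l20 expr0n /= pmulr_rle0 in H.
set a := q2 - q1 in a0 *; set b := q1 - q0 in b0 hb.
suff hQ : a * b * Q <= b * l2 ^+ 2 - a * l1 ^+ 2.
  rewrite -(ler_pM2l b0); nra.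
(* If [q0 * q2 = q1 ^+ 2], the Gram inequality no longer sees [Q]: it only makes [(l1, l2)]
   proportional to [(q0, q1)], and [q0 * Q <= l1 ^+ 2] gives the bound. *)
move: D; rewrite le_eqVlt => /predU1P[e|D].
  have e1 : q0 * l2 = q1 * l1.
    apply/eqP; rewrite -subr_eq0 -sqrf_eq0 eq_le sqr_ge0 andbT.
    have -> : (q0 * l2 - q1 * l1) ^+ 2 =
        q0 * (q0 * l2 ^+ 2 - 2 * q1 * l1 * l2 + q2 * l1 ^+ 2)
        + (q1 ^+ 2 - q0 * q2) * l1 ^+ 2 by ring.
    rewrite e subrr mul0r addr0 pmulr_rle0 //.
    by move: h3; rewrite e subrr mul0r add0r.
  have ea : a = q1 * b / q0.
    have -> : a = (q0 * q2 - q0 * q1) / q0 by rewrite /a; field; rewrite gt_eqF.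
    by rewrite e /b; field; rewrite gt_eqF.
  have el : l2 = q1 * l1 / q0 by rewrite -e1; field; rewrite gt_eqF.
  have -> : b * l2 ^+ 2 - a * l1 ^+ 2 = a * b * (l1 ^+ 2 / q0).
    by rewrite el ea /b; field; rewrite gt_eqF.
  by rewrite ler_pM2l ?mulr_gt0 // ler_pdivlMr // mulrC.
(* Multiplied by the positive determinant, the claim is the Gram inequality plus a square. *)
rewrite -subr_gt0 in D.
rewrite -(ler_pM2l D) -subr_ge0.
have -> : (q1 ^+ 2 - q0 * q2) * (b * l2 ^+ 2 - a * l1 ^+ 2) - (q1 ^+ 2 - q0 * q2) * (a * b * Q)
  = a * b * - ((q1 ^+ 2 - q0 * q2) * Q + q0 * l2 ^+ 2 - 2 * q1 * l1 * l2 + q2 * l1 ^+ 2)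
    + q1 * (a * l1 - b * l2) ^+ 2 by rewrite /a /b; ring.
apply: addr_ge0; apply: mulr_ge0; rewrite ?sqr_ge0 ?oppr_ge0 //; last exact: ltW.
by rewrite mulr_ge0 // ltW.
Qed.

(** At the mode the square in the Gram identity is [(a * l1 + b * l2) ^+ 2], with [a = q1 - q2] and
    [b = q1 - q0]. It vanishes on the hyperplane, so for [b > 0] one gets
    [Q <= - l1 ^+ 2 / b - l2 ^+ 2 / a], cancelling the bounds on [S] and [S']. *)
Lemma dominated_join (R : realFieldType) (q0 q1 q2 l1 l2 Q S S' : R) :
  0 < q0 -> 0 < q1 -> 0 < q2 -> q0 <= q1 -> q2 < q1 ->
  chain_ineq q0 q1 q2 l1 l2 Q -> dominated (q1 - q0) l1 S ->
  dominated (q1 - q2) l2 S' ->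
  (q1 - q2) * l1 + (q1 - q0) * l2 = 0 -> S + Q + S' <= 0.
Proof.
move=> q0p q1p q2p q01 q21 [h1 h2 h3] [hb hl] [hb' hl'] hyp.
have a0 : 0 < q1 - q2 by rewrite subr_gt0.
move: q01; rewrite le_eqVlt => /predU1P[e|q01].
  subst q0; move/eqP: hyp; rewrite subrr mul0r addr0 mulf_eq0 gt_eqF //= => /eqP l10.
  subst l1; have S0 := hl erefl.
  have hQ : (q1 - q2) * Q <= - l2 ^+ 2.
    have : q1 * ((q1 - q2) * Q + l2 ^+ 2) <= 0 by nra.
    by rewrite pmulr_rle0 // => ?; lra.
  have : (q1 - q2) * (Q + S') <= 0 by lra.
  by rewrite pmulr_rle0 // => ?; lra.
have b0 : 0 < q1 - q0 by rewrite subr_gt0.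
have D : 0 < q1 ^+ 2 - q0 * q2 by nra.
set a := q1 - q2 in a0 hb' hyp *; set b := q1 - q0 in b0 hb hyp.
have hQ : a * b * Q + a * l1 ^+ 2 + b * l2 ^+ 2 <= 0.
  rewrite -(pmulr_rle0 _ D).
  have -> : (q1 ^+ 2 - q0 * q2) * (a * b * Q + a * l1 ^+ 2 + b * l2 ^+ 2) =
    a * b * ((q1 ^+ 2 - q0 * q2) * Q + q0 * l2 ^+ 2 - 2 * q1 * l1 * l2 + q2 * l1 ^+ 2)
    + q1 * (a * l1 + b * l2) ^+ 2 by rewrite /a /b; ring.
  by rewrite hyp expr0n mulr0 addr0 pmulr_rle0 ?mulr_gt0.
rewrite -(pmulr_rle0 _ (mulr_gt0 a0 b0)).
have := ler_wpM2l (ltW a0) hb; have := ler_wpM2l (ltW b0) hb'.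
lra.
Qed.

(** By log-concavity [q] never rises after a descent, so [dominated_step], read from right to left,
    builds the sum up from its far end. *)
Lemma dominated_tail (R : realFieldType) m (q l Q : nat -> R) :
  (forall t, 0 < q t) -> (forall t, q t * q t.+2 <= q t.+1 ^+ 2) ->
  (forall t, chain_ineq (q t) (q t.+1) (q t.+2) (l t) (l t.+1) (Q t)) ->
  q 1%N <= q 0%N -> dominated (q 0%N - q 1%N) (l 0%N) (\sum_(t < m) Q t).
Proof.
elim: m q l Q => [|m IH] q l Q qp qc ch q10.
  by rewrite big_ord0; split; rewrite ?mulr0 ?sqr_ge0.
have q21 : q 2 <= q 1%N by have := qc 0%N; have := qp 1%N; have := qp 2; nra.
rewrite big_ord_recl /= [X in dominated _ _ X]addrC.
apply: (@dominated_step _ (q 2) _ _ (l 1%N)) => //.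
- by rewrite mulrC.
- exact: chain_ineq_sym.
- exact: (IH (q \o S) (l \o S) (Q \o S) (fun t => qp _) (fun t => qc _) (fun t => ch t.+1) q21).
Qed.

(* i, a and b do not depend on l and Q: they define the hyperplane. *)
Lemma sum_chain_le0 (R : realFieldType) m (q : nat -> R) :
  (forall t, 0 < q t) -> (forall t, q t * q t.+2 <= q t.+1 ^+ 2) ->
  exists i a b, forall l Q : nat -> R,
  (forall t, chain_ineq (q t) (q t.+1) (q t.+2) (l t) (l t.+1) (Q t)) ->
  a * l i + b * l i.+1 = 0 -> \sum_(t < m) Q t <= 0.
Proof.
move=> qp qc; have [q10|/ltW q01] := lerP (q 1%N) (q 0%N).
  exists 0%N, 1, 0 => l Q ch; rewrite mul1r mul0r addr0.
  by case: (dominated_tail m qp qc ch q10).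
(* [S] accumulates the terms already passed while [q] increases; it starts at 0. *)
suff [i [a [b H]]] : exists i a b, forall S (l Q : nat -> R),
  (forall t, chain_ineq (q t) (q t.+1) (q t.+2) (l t) (l t.+1) (Q t)) ->
  dominated (q 1%N - q 0%N) (l 0%N) S ->
  a * l i + b * l i.+1 = 0 -> S + \sum_(t < m) Q t <= 0.
  exists i, a, b => l Q ch hl; rewrite -[X in X <= 0]add0r; apply: H ch _ hl.
  by split; rewrite ?mulr0 ?sqr_ge0.
elim: m q qp qc q01 => [|m IH] q qp qc q01.
  exists 0%N, 1, 0 => S l Q ch [_ h]; rewrite mul1r mul0r addr0 big_ord0 addr0.
  exact: h.
have [q12|q21] := lerP (q 1%N) (q 2).
  have [i [a [b H]]] := IH (q \o S) (fun t => qp _) (fun t => qc _) q12.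
  exists i.+1, a, b => S0 l Q ch dom hl.
  rewrite big_ord_recl addrA; apply: (H _ (l \o S) (Q \o S)) => // [t|].
    exact: (ch t.+1).
  exact: (dominated_step _ _ _ (qc 0%N) _ (ch 0%N)).
(* The mode is [q 1]: the accumulated bound meets the bound on the decreasing tail. *)
exists 0%N, (q 1%N - q 2), (q 1%N - q 0%N) => S0 l Q ch dom hl.
rewrite big_ord_recl addrA.
apply: (dominated_join _ _ _ q01 q21 (ch 0%N) dom) => //.
exact: (@dominated_tail _ m (q \o S) (l \o S) (Q \o S) (fun t => qp _)
  (fun t => qc _) (fun t => ch t.+1) (ltW q21)).
Qed.

(** * Forms with at most one positive eigenvalue, and the addition of an edge *)

Section Forms.
Variables (R : realFieldType) (n : nat).
Implicit Types (c : 'rV[int]_n -> R) (b : 'rV[int]_n) (x y u : 'rV[R]_n).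

(** A Hessian: for [b >= 0] its entries are the partial derivatives at 0, of orders b + e_k + e_l,
    of the formal series with terms c(v) x^v / v!. *)
Definition hess c b x y : R :=
  \sum_k \sum_l c (b + basis_vec k + basis_vec l) * (x 0 k * y 0 l).

Lemma hessC c b x y : hess c b x y = hess c b y x.
Proof.
rewrite /hess exchange_big; apply: eq_bigr => k _; apply: eq_bigr => l _.
by rewrite addrAC [x 0 l * _]mulrC.
Qed.

Lemma hessDZr c b x a y z : hess c b x (a *: y + z) = a * hess c b x y + hess c b x z.
Proof.
rewrite /hess mulr_sumr -big_split; apply: eq_bigr => k _.
rewrite mulr_sumr -big_split; apply: eq_bigr => l _ /=.
by rewrite !mxE; ring.
Qed.

Lemma hessDZl c b x a y z : hess c b (a *: y + z) x = a * hess c b y x + hess c b z x.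
Proof. by rewrite hessC hessDZr ![hess c b x _]hessC. Qed.

Lemma hess_delta c b k y :
  hess c b (delta_mx 0 k) y = \sum_l c (b + basis_vec k + basis_vec l) * y 0 l.
Proof.
rewrite /hess (bigD1 k) //= [X in _ + X]big1 ?addr0 => [|i ik].
  by apply: eq_bigr => l _; rewrite mxE !eqxx mul1r.
by apply: big1 => l _; rewrite mxE (negPf ik) andbF mul0r mulr0.
Qed.

Lemma hess_delta2 c b k l :
  hess c b (delta_mx 0 k) (delta_mx 0 l) = c (b + basis_vec k + basis_vec l).
Proof.
rewrite hess_delta (bigD1 l) //= big1 ?addr0 => [|i il].
  by rewrite mxE !eqxx mulr1.
by rewrite mxE (negPf il) andbF mulr0.
Qed.

(* The reversed Cauchy-Schwarz inequality: each form has at most one positive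
   eigenvalue. *)
Definition lorentzian c := forall b u x,
  0 < hess c b u u -> hess c b u u * hess c b x x <= hess c b u x ^+ 2.

(** A vector [u] of positive value lies off the hyperplane, so [x] can be moved into it along [u];
    completing the square in the resulting inequality gives the claim. *)
Lemma lorentzian_hyperplane c :
  (forall b, exists lam : 'rV[R]_n -> R,
     (forall a x y, lam (a *: x + y) = a * lam x + lam y) /\
     (forall x, lam x = 0 -> hess c b x x <= 0)) -> lorentzian c.
Proof.
move=> H b u x; have [lam [lamL lamN]] := H b => u0.
have lu : lam u != 0 by apply: contraTneq u0 => /lamN; rewrite leNgt.
pose s := - (lam x / lam u).
have /lamN : lam (s *: u + x) = 0 by rewrite lamL /s; field.
rewrite hessDZr !hessDZl (hessC _ _ x u) => h.
have : hess c b u u * (s * (s * hess c b u u + hess c b u x) + (s * hess c b u x + hess c b x x)) <= 0.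
  by rewrite pmulr_rle0.
have := sqr_ge0 (s * hess c b u u + hess c b u x); nra.
Qed.

Lemma lorentzianZ (k : R) c : 0 < k -> lorentzian (fun v => k * c v) -> lorentzian c.
Proof.
move=> k0 H b u x; have := H b u x.
have E y z : hess (fun v => k * c v) b y z = k * hess c b y z.
  rewrite /hess mulr_sumr; apply: eq_bigr => i _; rewrite mulr_sumr.
  by apply: eq_bigr => j _; rewrite -mulrA.

rewrite !E pmulr_rgt0 // => h /h.
have -> : k * hess c b u u * (k * hess c b x x) = k ^+ 2 * (hess c b u u * hess c b x x) by ring.
by rewrite exprMn ler_pM2l // exprn_gt0.
Qed.

(** Reversed Cauchy-Schwarz for [d i] against [s *: d j + x] says that a quadratic in [s] is
    nonnegative. Its discriminant condition is the Gram inequality times the positive value at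
    [d i]. *)
Lemma lorentzian_chain_ineq c b x i j : (forall v, 0 < c v) -> lorentzian c ->
  let d k : 'rV[R]_n := delta_mx 0 k in
  chain_ineq (hess c b (d i) (d i)) (hess c b (d i) (d j)) (hess c b (d j) (d j))
    (hess c b (d i) x) (hess c b (d j) x) (hess c b x x).
Proof.
move=> c0 L d.
have p k l : 0 < hess c b (d k) (d l) by rewrite hess_delta2.
split; [exact: L|exact: L|].
rewrite -(pmulr_rle0 _ (p i i)).
suff : (hess c b (d i) x * hess c b (d i) (d j) - hess c b (d i) (d i) * hess c b (d j) x) ^+ 2
  <= (hess c b (d i) x ^+ 2 - hess c b (d i) (d i) * hess c b x x) *
     (hess c b (d i) (d j) ^+ 2 - hess c b (d i) (d i) * hess c b (d j) (d j)).
  by nra.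
apply: discriminant_le => [|s]; first by rewrite subr_ge0 L.
have := L b (d i) (s *: d j + x) (p i i).
rewrite -subr_ge0 !hessDZr !hessDZl (hessC _ _ x) => h.
lra.
Qed.

Lemma lorentzian_sum_edge N c i j : (forall v, 0 < c v) -> lorentzian c ->
  lorentzian (fun v => \sum_(t < N) c (v - (basis_vec i - basis_vec j) *+ t)).
Proof.
move=> c0 L; apply: lorentzian_hyperplane => b.
pose d k : 'rV[R]_n := delta_mx 0 k.
pose B t := b - (basis_vec i - basis_vec j) *+ t.
(* Since B_t + e_j = B_{t+1} + e_i, the Gram entries of [d i], [d j] in the [t]-th form are [q t],
   [q t.+1], [q t.+2]. *)
have shift t x : hess c (B t) (d j) x = hess c (B t.+1) (d i) x.
  rewrite !hess_delta; apply: eq_bigr => l _; congr (c (_ + _) * _).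
  by rewrite /B mulrSr opprD addrA opprB -!addrA addNr addr0.
pose q t := hess c (B t) (d i) (d i).
have qE t : hess c (B t) (d i) (d j) = q t.+1 by rewrite hessC shift.
have qE2 t : hess c (B t) (d j) (d j) = q t.+2 by rewrite shift qE.
have q0 t : 0 < q t by rewrite /q hess_delta2.
have qc t : q t * q t.+2 <= q t.+1 ^+ 2 by rewrite -qE2 -qE; exact: (L _ _ _ (q0 t)).
have [k [a [a' H]]] := sum_chain_le0 N q0 qc.
exists (fun x => a * hess c (B k) (d i) x + a' * hess c (B k.+1) (d i) x).
split=> [s x y|x hx]; first by rewrite !hessDZr; ring.
have -> : hess (fun v => \sum_(t < N) c (v - (basis_vec i - basis_vec j) *+ t)) b x x
   = \sum_(t < N) hess c (B t) x x.
  rewrite /hess [RHS]exchange_big; apply: eq_bigr => r _; rewrite [RHS]exchange_big.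
  apply: eq_bigr => l _; rewrite mulr_suml; apply: eq_bigr => t _.
  by rewrite /B -!addrA [_ + (_ + - _)]addrA [_ - _]addrC !addrA.
apply: (H (fun t => hess c (B t) (d i) x) (fun t => hess c (B t) x x)) => // t.
have := lorentzian_chain_ineq (B t) x i j c0 L.
by rewrite /= -/(d i) -/(d j) qE qE2 shift.
Qed.

(** * The Gaussian weight, for a graph without edges *)

Definition sqnorm b : nat := (\sum_k `|b 0%R k| ^ 2)%N.

Lemma sqnormE b : (sqnorm b)%:Z = \sum_k b 0 k ^+ 2.
Proof.
rewrite /sqnorm -natz natr_sum; apply: eq_bigr => k _.
by rewrite natrX natz abszE real_normK ?num_real.
Qed.

Lemma sqnormD_basis b k l :
  (sqnorm (b + basis_vec k + basis_vec l))%:Z =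
  (sqnorm b)%:Z + 2 * b 0 k + 2 * b 0 l + 2 + 2 * (k == l)%:Z.
Proof.
have E (i : 'I_n) v : (sqnorm (v + basis_vec i))%:Z = (sqnorm v)%:Z + 2 * v 0 i + 1.
  rewrite !sqnormE (bigD1 i) //= [X in _ = X + _ + _](bigD1 i) //= !mxE !eqxx /=.
  rewrite (eq_bigr (fun k => v 0 k ^+ 2)) => [|m mi]; first by ring.
  by rewrite !mxE (negPf mi) addr0.
by rewrite !E !mxE /= eq_sym; case: eqP => _ /=; ring.
Qed.

(** Expanding the squared norm shows the form to be a positive multiple of [(\sum_k w k * x 0 k) ^+
    2 - (1 - r ^+ 2) * \sum_k (w k * x 0 k) ^+ 2]. *)
Lemma lorentzian_gauss r : 0 < r -> r <= 1 -> lorentzian (fun v => r ^+ sqnorm v).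
Proof.
move=> r0 r1; apply: lorentzian_hyperplane => b.
have rn0 : r != 0 by rewrite gt_eqF.
pose w k := r ^ (2 * b 0 k).
exists (fun x => \sum_k w k * x 0 k); split=> [a x y|x hx].
  rewrite mulr_sumr -big_split; apply: eq_bigr => k _; rewrite !mxE /=; ring.
have E k l : r ^+ sqnorm (b + basis_vec k + basis_vec l) =
    r ^+ (sqnorm b + 2) * (w k * w l) * (1 - (1 - r ^+ 2) * (k == l)%:R).
  rewrite [LHS]exprnP sqnormD_basis !expfzDr // -/(w k) -/(w l) !expr1z exprD.
  have -> : r ^ (2 * (k == l)%:Z) = 1 - (1 - r ^+ 2) * (k == l)%:R.
    by case: (k == l); rewrite ?mulr1 ?mulr0 ?expr0z -?exprnP; ring.
  by rewrite -exprnP; ring.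
have -> : hess (fun v => r ^+ sqnorm v) b x x =
   r ^+ (sqnorm b + 2) * ((\sum_k w k * x 0 k) ^+ 2
      - (1 - r ^+ 2) * \sum_k (w k * x 0 k) ^+ 2).
  rewrite [in RHS]expr2 mulr_suml [in X in _ - X]mulr_sumr -sumrB mulr_sumr /hess.
  apply: eq_bigr => k _.
  rewrite mulr_sumr (bigD1 k) //= [in RHS](bigD1 k) //= E eqxx.
  rewrite [X in _ = _ * X]addrAC [RHS]mulrDr mulr_sumr.
  congr (_ + _); first by rewrite mulr1; ring.
  by apply: eq_bigr => l lk; rewrite E eq_sym (negPf lk) mulr0; ring.
rewrite hx expr0n /= sub0r mulrN oppr_le0; apply: mulr_ge0.
  by rewrite exprn_ge0 // ltW.
apply: mulr_ge0; first by rewrite subr_ge0 exprn_ile1 // ltW.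
by apply: sumr_ge0 => k _; apply: sqr_ge0.
Qed.
End Forms.

(** * Gaussian-weighted sums over bounded flows *)

Definition ffun_update (T J : finType) (g : {ffun T -> J}) e t : {ffun T -> J} :=
  [ffun x => if x == e then t else g x].

(** Splits off the value at [e] without changing the index type: on the right [g] keeps an idle
    value at [e], whence the factor [#|J|]. *)
Lemma sum_ffun_coord (T J : finType) (V : nmodType) (e : T)
    (F : J -> {ffun T -> J} -> V) :
  (forall t g u, F t (ffun_update g e u) = F t g) ->
  (\sum_(g : {ffun T -> J}) F (g e) g) *+ #|J| = \sum_t \sum_g F t g.
Proof.
(* [h] exchanges the value at [e] with the free argument. *)
move=> HF; pose h (p : J * {ffun T -> J}) := (p.2 e, ffun_update p.2 e p.1).
have hK : involutive h.
  move=> [t g]; rewrite /h /= /ffun_update ffunE eqxx; congr (_, _).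
  by apply/ffunP => x; rewrite !ffunE; case: eqP => // ->.
rewrite [RHS]pair_big (reindex_inj (inv_inj hK)) /=.
under [RHS]eq_bigr do rewrite HF.
rewrite -(pair_big xpredT xpredT (fun (t : J) (g : {ffun T -> J}) => F (g e) g)) /=.
by rewrite sumr_const.
Qed.

Section Flows.
Variables (n : nat) (G : increasing_digraph n).

Definition edge_vec (x : edge G) : 'rV[int]_n := basis_vec (src x) - basis_vec (tgt x).

(** Induction adds one edge at a time to the Gaussian. Values of [g] outside [s] only contribute a
    constant multiplicity, removed by [lorentzianZ]. *)
Lemma lorentzian_flow_sum (R : realFieldType) (r : R) N (s : seq (edge G)) :
  0 < r -> r <= 1 -> uniq s ->
  lorentzian (fun v => \sum_(g : {ffun edge G -> 'I_N.+1})
    r ^+ sqnorm (v - \sum_(x <- s) edge_vec x *+ g x)).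
Proof.
move=> r0 r1; pose M := #|{ffun edge G -> 'I_N.+1}|.
have M0 : (0 < M)%N by apply/card_gt0P; exists [ffun=> ord0].
elim: s => [_|e s IH /= /andP[es us]].
  apply: (@lorentzianZ _ _ M%:R^-1); first by rewrite invr_gt0 ltr0n.
  rewrite (_ : (fun v => _) = fun v => r ^+ sqnorm v); first exact: lorentzian_gauss.
  apply: funext => v; under eq_bigr do rewrite big_nil subr0.
  by rewrite sumr_const -/M -[r ^+ _ *+ M]mulr_natl mulKf // pnatr_eq0 -lt0n.
apply: (@lorentzianZ _ _ N.+1%:R); first by rewrite ltr0n.
set c := (fun v => _) in IH.
rewrite (_ : (fun v => _) = fun v => \sum_(t < N.+1) c (v - edge_vec e *+ t)).
  apply: lorentzian_sum_edge; last exact: IH.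
  move=> v; rewrite /c lt_neqAle eq_sym sumr_ge0 ?andbT => [|g _]; last exact/exprn_ge0/ltW.
  apply/negP => /eqP/psumr_eq0P => h.
  have /eqP := h (fun g _ => exprn_ge0 _ (ltW r0)) [ffun=> ord0] isT.
  by rewrite gt_eqF ?exprn_gt0.
apply: funext => v; rewrite mulr_natl.
pose F (t : 'I_N.+1) (g : {ffun edge G -> 'I_N.+1}) :=
  r ^+ sqnorm (v - edge_vec e *+ t - \sum_(x <- s) edge_vec x *+ g x).
have := @sum_ffun_coord _ _ R e F; rewrite card_ord => <- => [|t g u].
  by congr (_ *+ _); apply: eq_bigr => g _; rewrite big_cons opprD addrA.
congr (_ ^+ sqnorm (_ - _)); apply: eq_big_seq => x xs.
by rewrite ffunE; case: eqP => // xe; rewrite -xe xs in es.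
Qed.

Definition bounded_flows N (v : 'rV[int]_n) : {set {ffun edge G -> 'I_N.+1}} :=
  [set g : {ffun edge G -> 'I_N.+1} | v == \sum_x edge_vec x *+ g x].

Lemma kostant_bounded_flows N v :
  (forall f : {ffun edge G -> nat}, kostant_flows G v f -> forall x, (f x <= N)%N) ->
  kostant G v = #|bounded_flows N v|.
Proof.
move=> fN.
pose widen (g : {ffun edge G -> 'I_N.+1}) : {ffun edge G -> nat} := [ffun x => g x : nat].
have widen_inj : injective widen.
  by move=> g h /ffunP gh; apply/ffunP => x; have := gh x; rewrite !ffunE => /val_inj.
rewrite /kostant (_ : fset_set _ = [fset widen g | g in bounded_flows N v]%fset).
  by rewrite card_imfset //= -cardE.
apply/fsetP => f; rewrite in_fset_set; last exact: finite_kostant_flows.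
apply/idP/imfsetP => [/set_mem fv|[g /=]].
  exists [ffun x => inord (f x)] => /=.
    rewrite inE -fv; apply/eqP/eq_bigr => x _.
    by rewrite ffunE inordK // ltnS (fN _ fv).
  by apply/ffunP => x; rewrite !ffunE inordK // ltnS (fN _ fv).
rewrite !inE => /eqP -> ->; rewrite /kostant_flows /=.
by apply: eq_bigr => x _; rewrite ffunE.
Qed.

Lemma kostant_flows_bound v : exists N, forall f : {ffun edge G -> nat},
  kostant_flows G v f -> forall x, (f x <= N)%N.
Proof.
exists (\max_(f <- fset_set (kostant_flows G v)) \max_x f x)%N => f fv x.
have fin : f \in fset_set (kostant_flows G v).
  by rewrite in_fset_set ?mem_set //; apply: finite_kostant_flows.
apply: leq_trans (leq_bigmax (F := f) x) _.
exact: (@leq_bigmax_seq _ (enum_fset (fset_set (kostant_flows G v))) xpredT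
  (fun f : {ffun edge G -> nat} => \max_x f x)%N f fin isT).
Qed.

Lemma bounded_flows_sum_ge (R : realFieldType) (r : R) N v : 0 <= r ->
  #|bounded_flows N v|%:R <= \sum_(g : {ffun edge G -> 'I_N.+1})
    r ^+ sqnorm (v - \sum_x edge_vec x *+ g x).
Proof.
move=> r0; rewrite (bigID (fun g => g \in bounded_flows N v)) /=.
rewrite -[X in X <= _]addr0 lerD //; last by apply: sumr_ge0 => g _; apply: exprn_ge0.
rewrite -sumr_const; apply: ler_sum => g; rewrite inE => /eqP <-.
by rewrite subrr /sqnorm big1 // => k _; rewrite mxE.
Qed.

(** A flow that misses [v] misses it by a nonzero integer vector, so its weight is at most [r]. *)
Lemma bounded_flows_sum_le (R : realFieldType) (r : R) N v : 0 <= r -> r <= 1 ->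
  \sum_(g : {ffun edge G -> 'I_N.+1}) r ^+ sqnorm (v - \sum_x edge_vec x *+ g x)
  <= #|bounded_flows N v|%:R + r * #|{ffun edge G -> 'I_N.+1}|%:R.
Proof.
move=> r0 r1; rewrite (bigID (fun g => g \in bounded_flows N v)) /= lerD //.
  by rewrite -sumr_const; apply: ler_sum => g _; apply: exprn_ile1.
apply: (@le_trans _ _ (\sum_(g : {ffun edge G -> 'I_N.+1}) r)); last first.
  by rewrite sumr_const mulr_natr.
rewrite big_mkcond; apply: ler_sum => g _; case: ifP => //.
rewrite inE -subr_eq0; set w := v - _ => wn0.
have [k wk] : exists k, w 0 k != 0.
  apply/existsP; apply: contraR wn0; rewrite negb_exists => /forallP h.
  apply/eqP/matrixP => i k; rewrite ord1 [RHS]mxE.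
  by have := h k; rewrite negbK => /eqP.
apply: (@le_trans _ _ (r ^+ 1)); last by rewrite expr1.
rewrite ler_wiXn2l // /sqnorm (bigD1 k) //= ltn_addr // expn_gt0 absz_gt0 wk //.
Qed.

End Flows.

(** * From weighted sums to counts *)

Theorem corollary5p2 (n : nat) (G : increasing_digraph n) (v : 'rV[int]_n)
    (i j : 'I_n) :
  (kostant G (v + basis_vec i - basis_vec j)
     * kostant G (v - basis_vec i + basis_vec j) <= kostant G v ^ 2)%N.
Proof.
set vp := v + _ - _; set vm := v - _ + _.
have [N0 h0] := kostant_flows_bound G v.
have [N1 h1] := kostant_flows_bound G vp.
have [N2 h2] := kostant_flows_bound G vm.
pose N := (N0 + N1 + N2)%N.
have -> : kostant G v = #|bounded_flows G N v|.
  by apply: kostant_bounded_flows => f /h0 fN x; rewrite (leq_trans (fN x)) // /N; lia.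
have -> : kostant G vp = #|bounded_flows G N vp|.
  by apply: kostant_bounded_flows => f /h1 fN x; rewrite (leq_trans (fN x)) // /N; lia.
have -> : kostant G vm = #|bounded_flows G N vm|.
  by apply: kostant_bounded_flows => f /h2 fN x; rewrite (leq_trans (fN x)) // /N; lia.
set M := #|{ffun edge G -> 'I_N.+1}|.
set k := #|bounded_flows G N v|; set a := #|_|; set b := #|_|.
(* Chosen so that [r = D^-1] makes [(k + r * M) ^+ 2 <= k ^+ 2 + r * (2 * k * M + M ^+ 2) < k ^+ 2 +
   1]. *)
pose D : rat := 1 + 2 * k%:R * M%:R + M%:R ^+ 2.
have k0 : 0 <= k%:R :> rat by rewrite ler0n.
have M0 : 0 <= M%:R :> rat by rewrite ler0n.
have D1 : 1 <= D by rewrite /D; nra.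
pose r : rat := D^-1.
have r0 : 0 < r by rewrite invr_gt0; lra.
have r1 : r <= 1 by rewrite invf_le1 //; lra.
pose c (u : 'rV[int]_n) := \sum_(g : {ffun edge G -> 'I_N.+1})
    r ^+ sqnorm (u - \sum_x edge_vec x *+ g x).
have lor : lorentzian c := 
  @lorentzian_flow_sum n G rat r N _ r0 r1 (index_enum_uniq (edge G)).
have cge u : #|bounded_flows G N u|%:R <= c u := bounded_flows_sum_ge G N u (ltW r0).
have cle : c v <= k%:R + r * M%:R := bounded_flows_sum_le G N v (ltW r0) r1.
have cc : c vp * c vm <= c v ^+ 2.
  have [p0|p0] := ltrP 0 (c vp); last first.
    have m0 : 0 <= c vm by apply: le_trans (cge _).
    by apply: le_trans (sqr_ge0 _); apply: mulr_le0_ge0.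
  (* At this base point the 2 x 2 minor has diagonal [c vp], [c vm] and off-diagonal entry [c v]. *)
  have := lor (v - basis_vec i - basis_vec j) (delta_mx 0 i) (delta_mx 0 j).
  rewrite !hess_delta2.
  have -> : v - basis_vec i - basis_vec j + basis_vec i + basis_vec i = vp.
    by apply/matrixP => x y; rewrite /vp !mxE; ring.
  have -> : v - basis_vec i - basis_vec j + basis_vec j + basis_vec j = vm.
    by apply/matrixP => x y; rewrite /vm !mxE; ring.
  have -> : v - basis_vec i - basis_vec j + basis_vec i + basis_vec j = v.
    by apply/matrixP => x y; rewrite !mxE; ring.
  exact.
(* Integrality lets one small [r] replace the limit. *)
suff : (a * b < k ^ 2 + 1)%N by rewrite addn1 ltnS.
rewrite -(ltr_nat rat) natrM natrD natrX.
have ab : a%:R * b%:R <= (k%:R + r * M%:R) ^+ 2.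
  apply: (@le_trans _ _ (c vp * c vm)); first by rewrite ler_pM ?ler0n ?cge.
  apply: le_trans cc _; rewrite ler_sqr ?nnegrE //.
    by apply: le_trans (cge v).
  by apply: le_trans cle; apply: le_trans (cge v).
apply: le_lt_trans ab _.
have rD : r * D = 1 by rewrite mulVf //; lra.
have rM : r ^+ 2 * M%:R ^+ 2 <= r * M%:R ^+ 2.
  by rewrite ler_wpM2r ?sqr_ge0 // expr2 ler_piMl // ltW.
move: rD; rewrite /D; nra.
Qed.
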